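(* Let $(\mathcal{A},\mu,\Delta)$ be a finite-dimensional totally associative $3$-ary infinitesimal bialgebra over $\mathcal{K}$. Then $(\mathcal{A}^{*},\Delta^{*},\mu^{*})$ is a totally associative $3$-ary infinitesimal bialgebra.
   Context: $\mathcal{K}$ is a fixed field of characteristic zero. A totally associative $3$-ary infinitesimal bialgebra is a triple $(\mathcal{A},\mu,\Delta)$ with $\mu:\mathcal{A}^{\otimes3}\to\mathcal{A}$ and $\Delta:\mathcal{A}\to\mathcal{A}^{\otimes3}$ linear such that: (1) $\mu\circ(\mu\otimes\mathrm{id}\otimes\mathrm{id})=\mu\circ(\mathrm{id}\otimes\mu\otimes\mathrm{id})=\mu\circ(\mathrm{id}\otimes\mathrm{id}\otimes\mu)$ (totally associative $3$-ary algebra); (2) $(\Delta\otimes\mathrm{id}\otimes\mathrm{id})\circ\Delta=(\mathrm{id}\otimes\Delta\otimes\mathrm{id})\circ\Delta=(\mathrm{id}\otimes\mathrm{id}\otimes\Delta)\circ\Delta$ (totally coassociative $3$-ary coalgebra); (3) for all $x,y,z\in\mathcal{A}$, $\Delta\mu(x,y,z)=(L_\mu(x,y)\otimes\mathrm{id}\otimes\mathrm{id})\Delta(z)+(\mathrm{id}\otimes M_\mu(x,z)\otimes\mathrm{id})\Delta(y)+(\mathrm{id}\otimes\mathrm{id}\otimes R_\mu(y,z))\Delta(x)$, where $L_\mu(x,y)(z)=\mu(x,y,z)$, $M_\mu(x,y)(z)=\mu(x,z,y)$, $R_\mu(x,y)(z)=\mu(z,x,y)$. The dual maps $\Delta^*:(\mathcal{A}^*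 )^{\otimes3}\to\mathcal{A}^*$ (the product on $\mathcal{A}^*$) and $\mu^*:\mathcal{A}^*\to(\mathcal{A}^* )^{\otimes3}$ (the coproduct on $\mathcal{A}^*$) are given by $\langle\Delta^*(\xi,\eta,\gamma),x\rangle=\langle\xi\otimes\eta\otimes\gamma,\Delta(x)\rangle$ and $\langle\mu^*(\xi),x\otimes y\otimes z\rangle=\langle\xi,\mu(x,y,z)\rangle$, with $\langle\xi\otimes\eta\otimes\gamma,x\otimes y\otimes z\rangle=\xi(x)\eta(y)\gamma(z)$. *)

(* Defs.v *)
From HB Require Import structures.
From mathcomp Require Import all_boot all_order all_algebra.

Set Implicit Arguments.
Unset Strict Implicit.
Unset Printing Implicit Defensive.

Import GRing.Theory.
Local Open Scope ring_scope.

(* MathComp has no tensor products.  The tensor product of two finite-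
   dimensional spaces is built here from coordinates in their standard bases;
   tliftE, tensor_ext and tensP give its universal property, so that nothing
   below depends on the choice of these bases. *)

Section Tensor.
Variable K : fieldType.
Implicit Types U V W : vectType K.

Definition tensor V W : vectType K := 'M[K]_(\dim {:V}, \dim {:W}).

Definition tens V W (v : V) (w : W) : tensor V W :=
  \matrix_(i, j) (coord (vbasis {:V}) i v * coord (vbasis {:W}) j w).

Definition bilin V W U (f : V -> W -> U) : Prop := bilinear_for *:%R *:%R f.

(* The linear map on V (x) W induced by f; meaningful when f is bilinear. *)
Definition tlift V W U (f : V -> W -> U) : 'Hom(tensor V W, U) :=
  linfun (fun t : 'M[K]_(\dim {:V}, \dim {:W}) =>
    \sum_i \sum_j t i j *: f (vbasis {:V})`_i (vbasis {:W})`_j).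

Definition tmap V V' W W' (f : 'Hom(V, V')) (g : 'Hom(W, W')) :
  'Hom(tensor V W, tensor V' W') := tlift (fun v w => tens (f v) (g w)).

Definition assocr U V W :
    'Hom(tensor (tensor U V) W, tensor U (tensor V W)) :=
  tlift (fun t w => tlift (fun u v => tens u (tens v w)) t).

Definition assocl U V W :
    'Hom(tensor U (tensor V W), tensor (tensor U V) W) :=
  tlift (fun u t => tlift (fun v w => tens (tens u v) w) t).

End Tensor.

Notation "v '\ox' w" := (tens v w)
  (at level 40, left associativity) : ring_scope.
Notation "f '\ot' g" := (tmap f g)
  (at level 40, left associativity) : ring_scope.

Section TensorTheory.
Variable K : fieldType.
Implicit Types U V W : vectType K.

Lemma tens_bilin V W : bilin (@tens K V W).
Proof.
split=> [w|v] a x y; apply/matrixP=> i j; rewrite !mxE linearP.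
  by rewrite mulrDl mulrA.
by rewrite mulrDr mulrCA.
Qed.

Lemma tens_linl V W a (x y : V) (w : W) :
  (a *: x + y) \ox w = a *: (x \ox w) + y \ox w.
Proof. exact: (tens_bilin V W).1. Qed.

Lemma tens_linr V W a (v : V) (x y : W) :
  v \ox (a *: x + y) = a *: (v \ox x) + v \ox y.
Proof. exact: (tens_bilin V W).2. Qed.

Fact tlift_linear V W U (f : V -> W -> U) :
  linear (fun t : 'M[K]_(\dim {:V}, \dim {:W}) =>
    \sum_i \sum_j t i j *: f (vbasis {:V})`_i (vbasis {:W})`_j).
Proof.
move=> a s t; rewrite scaler_sumr -big_split /=; apply: eq_bigr => i _.
rewrite scaler_sumr -big_split /=; apply: eq_bigr => j _.
by rewrite !mxE scalerDl scalerA.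
Qed.

Lemma linfun_linear V W (f : V -> W) : linear f -> linfun f =1 f.
Proof.
move=> fL v.
pose F := GRing.isLinear.Build K V W *:%R f fL.
pose FF : {linear V -> W} := HB.pack f F.
by rewrite -[f]/(FF : V -> W) lfunE.
Qed.

Lemma tliftDef V W U (f : V -> W -> U) (t : 'M[K]_(\dim {:V}, \dim {:W})) :
  tlift f t = \sum_i \sum_j t i j *: f (vbasis {:V})`_i (vbasis {:W})`_j.
Proof. by rewrite /tlift linfun_linear //; apply: tlift_linear. Qed.

Lemma bilin_suml V W U (f : V -> W -> U) : bilin f ->
  forall I (r : seq I) (c : I -> K) (v : I -> V) w,
  f (\sum_(i <- r) c i *: v i) w = \sum_(i <- r) c i *: f (v i) w.
Proof.
move=> [fl _] I r c v w; elim: r => [|i r IHr]; last by rewrite !big_cons fl IHr.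
have /= := fl w (-1) 0 0; rewrite !big_nil scaler0 addr0 scaleN1r addNr; apply.
Qed.

Lemma bilin_sumr V W U (f : V -> W -> U) : bilin f ->
  forall I (r : seq I) (c : I -> K) v (w : I -> W),
  f v (\sum_(i <- r) c i *: w i) = \sum_(i <- r) c i *: f v (w i).
Proof.
move=> [_ fr] I r c v w; elim: r => [|i r IHr]; last by rewrite !big_cons fr IHr.
have /= := fr v (-1) 0 0; rewrite !big_nil scaler0 addr0 scaleN1r addNr; apply.
Qed.

Lemma tliftE V W U (f : V -> W -> U) : bilin f ->
  forall v w, tlift f (v \ox w) = f v w.
Proof.
move=> fB v w; rewrite tliftDef.
rewrite [in RHS](coord_vbasis (memvf v)) bilin_suml //; apply: eq_bigr => i _.
rewrite [in RHS](coord_vbasis (memvf w)) bilin_sumr // scaler_sumr.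
by apply: eq_bigr => j _; rewrite mxE scalerA.
Qed.

Lemma tensP V W (t : tensor V W) :
  t = \sum_i \sum_j (t : 'M[K]_(\dim {:V}, \dim {:W})) i j
        *: ((vbasis {:V})`_i \ox (vbasis {:W})`_j).
Proof.
have e (i : 'I_(\dim {:V})) (j : 'I_(\dim {:W})) :
    (vbasis {:V})`_i \ox (vbasis {:W})`_j = delta_mx i j.
  apply/matrixP=> k l; rewrite !mxE !coord_free ?(basis_free (vbasisP _)) //.
  by rewrite -natrM mulnb [i == k]eq_sym [j == l]eq_sym.
rewrite {1}[t]matrix_sum_delta; apply: eq_bigr => i _; apply: eq_bigr => j _.
by rewrite e.
Qed.

Lemma tensor_ext V W U (f g : 'Hom(tensor V W, U)) :
  (forall v w, f (v \ox w) = g (v \ox w)) -> f = g.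
Proof.
move=> efg; apply/lfunP=> t; rewrite [t]tensP !linear_sum; apply: eq_bigr => i _.
by rewrite !linear_sum; apply: eq_bigr => j _; rewrite !linearZ /= efg.
Qed.

Lemma tmapE V V' W W' (f : 'Hom(V, V')) (g : 'Hom(W, W')) v w :
  (f \ot g) (v \ox w) = f v \ox g w.
Proof.
rewrite tliftE //.
by split=> [y|x] a u u' /=; rewrite linearP !(tens_linl, tens_linr).
Qed.

Lemma tlift_bilinl V W U (X : vectType K) (f : X -> V -> W -> U) :
    (forall x, bilin (f x)) ->
    (forall a x y v w, f (a *: x + y) v w = a *: f x v w + f y v w) ->
  forall a x y t, tlift (f (a *: x + y)) t = a *: tlift (f x) t + tlift (f y) t.
Proof.
move=> fB fL a x y t.
suff -> : tlift (f (a *: x + y)) = a *: tlift (f x) + tlift (f y).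
  by rewrite add_lfunE scale_lfunE.
by apply: tensor_ext => v w; rewrite add_lfunE scale_lfunE !tliftE.
Qed.

Lemma assocrE U V W (u : U) (v : V) (w : W) :
  assocr U V W (u \ox v \ox w) = u \ox (v \ox w).
Proof.
have B w' : bilin (fun (u : U) (v : V) => u \ox (v \ox w')).
  by split=> [y|x] a b c /=; rewrite !(tens_linl, tens_linr).
rewrite tliftE ?tliftE //; split=> [w'|t] a x y /=; first by rewrite linearP.
apply: (tlift_bilinl (f := fun w' (u : U) (v : V) => u \ox (v \ox w'))) => //.
by move=> b w1 w2 u' v'; rewrite !tens_linr.
Qed.

Lemma assoclE U V W (u : U) (v : V) (w : W) :
  assocl U V W (u \ox (v \ox w)) = u \ox v \ox w.
Proof.
have B u' : bilin (fun (v : V) (w : W) => u' \ox v \ox w).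
  by split=> [y|x] a b c /=; rewrite !(tens_linl, tens_linr).
rewrite tliftE ?tliftE //; split=> [t|u'] a x y /=; last by rewrite linearP.
apply: (tlift_bilinl (f := fun u' (v : V) (w : W) => u' \ox v \ox w)) => //.
by move=> b w1 w2 u' v'; rewrite !tens_linl.
Qed.

End TensorTheory.

Section TensorPowers.
Variables (K : fieldType) (A : vectType K).

(* Tensor powers are associated to the left. *)
Definition T3 : vectType K := tensor (tensor A A) A.
Definition T5 : vectType K := tensor (tensor T3 A) A.

Lemma T3_ext (U : vectType K) (f g : 'Hom(T3, U)) :
  (forall x y z : A, f (x \ox y \ox z) = g (x \ox y \ox z)) -> f = g.
Proof.
move=> efg; apply: tensor_ext => t z.
pose h (f : 'Hom(T3, U)) (t : tensor A A) := f (t \ox z).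
have hE f' : linfun (h f') =1 h f'.
  by apply: linfun_linear => a u v; rewrite /h tens_linl linearP.
rewrite -[LHS]/(h f t) -[RHS]/(h g t) -!hE.
suff -> : linfun (h f) = linfun (h g) by [].
by apply: tensor_ext => x y; rewrite !hE; apply: efg.
Qed.

(* The identifications of A^(x)5 with A (x) A^(x)3 (x) A and with
   A (x) A (x) A^(x)3. *)
Definition split_mid : 'Hom(T5, tensor (tensor A T3) A) :=
  (assocr A (tensor A A) A \o (assocr A A A \ot \1))%VF \ot \1%VF.
Definition join_mid : 'Hom(tensor (tensor A T3) A, T5) :=
  ((assocl A A A \ot \1) \o assocl A (tensor A A) A)%VF \ot \1%VF.
Definition split_right : 'Hom(T5, tensor (tensor A A) T3) :=
  (assocr (tensor A A) (tensor A A) A \o (assocr (tensor A A) A A \ot \1))%VF.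
Definition join_right : 'Hom(tensor (tensor A A) T3, T5) :=
  ((assocl (tensor A A) A A \ot \1) \o assocl (tensor A A) (tensor A A) A)%VF.

Lemma split_midE (a b c d e : A) :
  split_mid (a \ox b \ox c \ox d \ox e) = a \ox (b \ox c \ox d) \ox e.
Proof. by rewrite tmapE comp_lfunE tmapE !id_lfunE !assocrE. Qed.

Lemma join_midE (a b c d e : A) :
  join_mid (a \ox (b \ox c \ox d) \ox e) = a \ox b \ox c \ox d \ox e.
Proof. by rewrite tmapE comp_lfunE assoclE tmapE !id_lfunE assoclE. Qed.

Lemma split_rightE (a b c d e : A) :
  split_right (a \ox b \ox c \ox d \ox e) = a \ox b \ox (c \ox d \ox e).
Proof. by rewrite comp_lfunE tmapE !id_lfunE !assocrE. Qed.

Lemma join_rightE (a b c d e : A) :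
  join_right (a \ox b \ox (c \ox d \ox e)) = a \ox b \ox c \ox d \ox e.
Proof. by rewrite comp_lfunE assoclE tmapE !id_lfunE assoclE. Qed.

End TensorPowers.

Section Bialgebra.
Variables (K : fieldType) (A : vectType K).
Implicit Types (mu : 'Hom(T3 A, A)) (Delta : 'Hom(A, T3 A)).

Definition totally_associative mu : Prop :=
  (mu \o (mu \ot \1 \ot \1) = mu \o (\1 \ot mu \ot \1) \o split_mid A)%VF /\
  (mu \o (\1 \ot mu \ot \1) \o split_mid A
     = mu \o (\1 \ot \1 \ot mu) \o split_right A)%VF.

Definition totally_coassociative Delta : Prop :=
  ((Delta \ot \1 \ot \1) \o Delta
     = join_mid A \o (\1 \ot Delta \ot \1) \o Delta)%VF /\
  (join_mid A \o (\1 \ot Delta \ot \1) \o Delta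
     = join_right A \o (\1 \ot \1 \ot Delta) \o Delta)%VF.

Definition Lmu mu (x y : A) : 'End(A) := linfun (fun z => mu (x \ox y \ox z)).
Definition Mmu mu (x y : A) : 'End(A) := linfun (fun z => mu (x \ox z \ox y)).
Definition Rmu mu (x y : A) : 'End(A) := linfun (fun z => mu (z \ox x \ox y)).

Definition infinitesimal_compat mu Delta : Prop :=
  forall x y z : A,
  Delta (mu (x \ox y \ox z)) =
    (Lmu mu x y \ot \1 \ot \1)%VF (Delta z)
    + (\1 \ot Mmu mu x z \ot \1)%VF (Delta y)
    + (\1 \ot \1 \ot Rmu mu y z)%VF (Delta x).

Record totally_assoc_inf_bialgebra mu Delta : Prop := TotAssocInfBialgebra {
  tib_assoc : totally_associative mu;
  tib_coassoc : totally_coassociative Delta;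
  tib_compat : infinitesimal_compat mu Delta
}.

Lemma LmuE mu x y z : Lmu mu x y z = mu (x \ox y \ox z).
Proof.
by apply: linfun_linear => a u v; rewrite tens_linr linearP.
Qed.

Lemma MmuE mu x y z : Mmu mu x y z = mu (x \ox z \ox y).
Proof.
apply: linfun_linear => a u v.
by rewrite tens_linr tens_linl linearP.
Qed.

Lemma RmuE mu x y z : Rmu mu x y z = mu (z \ox x \ox y).
Proof.
apply: linfun_linear => a u v.
by rewrite !tens_linl linearP.
Qed.

End Bialgebra.

Section Dual.
Variable K : fieldType.
Implicit Types V W : vectType K.

Definition transpose V W (f : 'Hom(V, W)) : 'Hom('Hom(W, K^o), 'Hom(V, K^o)) :=
  linfun (fun xi : 'Hom(W, K^o) => (xi \o f)%VF).

(* V^* (x) W^* -> (V (x) W)^*, with <xi (x) eta, v (x) w> = xi(v) eta(w). *)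
Definition pairing V W :
    'Hom(tensor 'Hom(V, K^o) 'Hom(W, K^o), 'Hom(tensor V W, K^o)) :=
  tlift (fun (xi : 'Hom(V, K^o)) (eta : 'Hom(W, K^o)) =>
    tlift (fun v w => xi v * eta w : K^o)).

Definition pairing3 V : 'Hom(T3 'Hom(V, K^o), 'Hom(T3 V, K^o)) :=
  (pairing (tensor V V) V \o (pairing V V \ot \1))%VF.

Definition dual_prod V (Delta : 'Hom(V, T3 V)) :
    'Hom(T3 'Hom(V, K^o), 'Hom(V, K^o)) :=
  (transpose Delta \o pairing3 V)%VF.

(* A two-sided inverse of pairing3 is meant: see pairing3_bij, which is where
   finite dimension is needed. *)
Definition dual_coprod V (mu : 'Hom(T3 V, V)) :
    'Hom('Hom(V, K^o), T3 'Hom(V, K^o)) :=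
  ((pairing3 V)^-1 \o transpose mu)%VF.

Lemma transposeE V W (f : 'Hom(V, W)) xi v : transpose f xi v = xi (f v).
Proof.
rewrite /transpose linfun_linear ?comp_lfunE // => a x y.
by apply/lfunP=> u; rewrite !(comp_lfunE, add_lfunE, scale_lfunE).
Qed.

Lemma pairingE V W (xi : 'Hom(V, K^o)) (eta : 'Hom(W, K^o)) v w :
  pairing V W (xi \ox eta) (v \ox w) = xi v * eta w.
Proof.
have B (x : 'Hom(V, K^o)) (y : 'Hom(W, K^o)) :
    bilin (fun v w => x v * y w : K^o).
  split=> [u|u] a b c /=; rewrite linearP /=.
    by rewrite mulrDl -scalerAl.
  by rewrite mulrDr -scalerAr.
rewrite tliftE ?tliftE //; split=> [y|x] a b c /=;
  apply: tensor_ext => v' w'; rewrite add_lfunE scale_lfunE !tliftE //.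
  by rewrite add_lfunE scale_lfunE mulrDl -scalerAl.
by rewrite add_lfunE scale_lfunE mulrDr -scalerAr.
Qed.

Lemma pairing_bij V W : bijective (pairing V W).
Proof.
pose e (i : 'I_(\dim {:V})) := (vbasis {:V})`_i.
pose e' (j : 'I_(\dim {:W})) := (vbasis {:W})`_j.
have cL (X : vectType K) i : linear (coord (vbasis {:X}) i : X -> K^o).
  by move=> a x y; rewrite linearP.
pose c i : 'Hom(V, K^o) := linfun (coord (vbasis {:V}) i : V -> K^o).
pose c' j : 'Hom(W, K^o) := linfun (coord (vbasis {:W}) j : W -> K^o).
have cE i v : c i v = coord (vbasis {:V}) i v by apply: linfun_linear.
have c'E j w : c' j w = coord (vbasis {:W}) j w by apply: linfun_linear.
pose g (phi : 'Hom(tensor V W, K^o)) : tensor 'Hom(V, K^o) 'Hom(W, K^o) :=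
  \sum_i \sum_j phi (e i \ox e' j) *: (c i \ox c' j).
have dec (X : vectType K) (x : 'Hom(X, K^o)) :
    x = \sum_(i < \dim {:X}) x (vbasis {:X})`_i
          *: linfun (coord (vbasis {:X}) i : X -> K^o).
  apply/lfunP=> v; rewrite {1}(coord_vbasis (memvf v)) linear_sum sum_lfunE.
  apply: eq_bigr => i _; rewrite linearZ scale_lfunE linfun_linear //=.
  by rewrite [LHS]mulrC.
have gL : linear g.
  move=> a x y; rewrite /g scaler_sumr -big_split; apply: eq_bigr => i _ /=.
  rewrite scaler_sumr -big_split; apply: eq_bigr => j _ /=.
  by rewrite add_lfunE scale_lfunE scalerDl scalerA.
exists g => [t|phi].
  rewrite -(linfun_linear gL) -comp_lfunE -[RHS]id_lfunE; congr (fun_of_lfun _ _).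
  apply: tensor_ext => x y; rewrite comp_lfunE linfun_linear // id_lfunE /g.
  rewrite [in RHS](dec _ x) (bilin_suml (@tens_bilin _ _ _)).
  apply: eq_bigr => i _.
  rewrite [in RHS](dec _ y) (bilin_sumr (@tens_bilin _ _ _)) scaler_sumr.
  by apply: eq_bigr => j _; rewrite pairingE scalerA.
apply: tensor_ext => v w; rewrite /g linear_sum sum_lfunE.
rewrite [in RHS](coord_vbasis (memvf v)) (bilin_suml (@tens_bilin _ _ _)).
rewrite linear_sum; apply: eq_bigr => i _; rewrite linear_sum sum_lfunE.
rewrite [in RHS](coord_vbasis (memvf w)) (bilin_sumr (@tens_bilin _ _ _)).
rewrite scaler_sumr linear_sum; apply: eq_bigr => j _.
rewrite !linearZ scale_lfunE pairingE cE c'E /=.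
by rewrite /GRing.scale /= mulrC -mulrA.
Qed.

Lemma pairing3E V (xi eta gamma : 'Hom(V, K^o)) x y z :
  pairing3 V (xi \ox eta \ox gamma) (x \ox y \ox z) = xi x * eta y * gamma z.
Proof. by rewrite comp_lfunE tmapE id_lfunE !pairingE. Qed.

Lemma pairing3_bij V : bijective (pairing3 V).
Proof.
have [g gK Kg] := pairing_bij V V.
have gL : linear g.
  by move=> a x y; apply: (can_inj gK); rewrite linearP /= !Kg.
suff B : bijective (pairing V V \ot (\1 : 'End('Hom(V, K^o))))%VF.
  apply: (eq_bij (bij_comp (pairing_bij (tensor V V) V) B)) => t /=.
  by rewrite comp_lfunE.
exists (linfun g \ot (\1 : 'End('Hom(V, K^o))))%VF => t;
  rewrite -comp_lfunE -[RHS]id_lfunE; congr (fun_of_lfun _ _);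
  apply: tensor_ext => x y; rewrite comp_lfunE !tmapE !id_lfunE.
  by rewrite (linfun_linear gL) gK.
by rewrite (linfun_linear gL) Kg.
Qed.

Lemma dual_prodE V (Delta : 'Hom(V, T3 V)) xi eta gamma x :
  dual_prod Delta (xi \ox eta \ox gamma) x
    = pairing3 V (xi \ox eta \ox gamma) (Delta x).
Proof. by rewrite comp_lfunE transposeE. Qed.

Lemma dual_coprodE V (mu : 'Hom(T3 V, V)) xi x y z :
  pairing3 V (dual_coprod mu xi) (x \ox y \ox z) = xi (mu (x \ox y \ox z)).
Proof.
have [g _ Kg] := pairing3_bij V.
rewrite /dual_coprod [X in pairing3 V X]comp_lfunE limg_lfunVK ?transposeE //.
by rewrite -[transpose mu xi]Kg memv_img ?memvf.
Qed.

Lemma dual_coprod_unique V (mu : 'Hom(T3 V, V))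
    (D : 'Hom('Hom(V, K^o), T3 'Hom(V, K^o))) :
  (forall xi x y z,
     pairing3 V (D xi) (x \ox y \ox z) = xi (mu (x \ox y \ox z))) ->
  D = dual_coprod mu.
Proof.
move=> DE; apply/lfunP=> xi; apply: (bij_inj (pairing3_bij V)).
by apply: T3_ext => x y z; rewrite DE dual_coprodE.
Qed.

Lemma dual_prod_unique V (Delta : 'Hom(V, T3 V))
    (m : 'Hom(T3 'Hom(V, K^o), 'Hom(V, K^o))) :
  (forall xi eta gamma x, m (xi \ox eta \ox gamma) x
     = pairing3 V (xi \ox eta \ox gamma) (Delta x)) ->
  m = dual_prod Delta.
Proof.
move=> mE; apply: T3_ext => xi eta gamma.
by apply/lfunP=> x; rewrite mE dual_prodE.
Qed.

End Dual.

(* Main.v *)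
(* Idea: the dual structure maps are the adjoints of Delta and mu for the
   pairings between tensor powers of A^* and of A.  Adjoints reverse
   composition, are compatible with tensor products, and are unique because
   the pairings are nondegenerate; so each associativity axiom of A^* is the
   adjoint of a coassociativity axiom of A, and conversely.  Compatibility is
   self-dual: evaluated on x, y, z, the L, M and R terms for A^* become the
   R, M and L terms for A. *)
Require Import Defs.
From mathcomp Require Import all_boot all_order all_algebra.
Import GRing.Theory.
Local Open Scope ring_scope.

Set Implicit Arguments.
Unset Strict Implicit.

(** * Adjoints with respect to pairings of vector spaces *)

Section Adjoints.
Context {K : fieldType}.
Implicit Types P Q R X Y Z : vectType K.

(** A pairing of [P] with [X] is encoded as a linear map from [P] to the dual of [X], so that
    nondegeneracy in [P] is injectivity. *)
Definition tens_pairing {P X Q Y} (p : 'Hom(P, 'Hom(X, K^o)))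
    (q : 'Hom(Q, 'Hom(Y, K^o))) :
    'Hom(tensor P Q, 'Hom(tensor X Y, K^o)) :=
  (pairing X Y \o (p \ot q))%VF.

Lemma tens_pairingE P X Q Y (p : 'Hom(P, 'Hom(X, K^o)))
    (q : 'Hom(Q, 'Hom(Y, K^o))) a b x y :
  tens_pairing p q (a \ox b) (x \ox y) = p a x * q b y.
Proof. by rewrite comp_lfunE tmapE pairingE. Qed.

Definition adjoint {P X Q Y} (p : 'Hom(P, 'Hom(X, K^o)))
    (q : 'Hom(Q, 'Hom(Y, K^o))) (F : 'Hom(Q, P)) (f : 'Hom(X, Y)) : Prop :=
  forall t x, p (F t) x = q t (f x).

Lemma adjoint1 P X (p : 'Hom(P, 'Hom(X, K^o))) : adjoint p p \1 \1.
Proof. by move=> t x; rewrite !id_lfunE. Qed.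

Lemma adjoint_comp P X Q Y R Z (p : 'Hom(P, 'Hom(X, K^o)))
    (q : 'Hom(Q, 'Hom(Y, K^o))) (r : 'Hom(R, 'Hom(Z, K^o))) F f G g :
  adjoint p q F f -> adjoint q r G g -> adjoint p r (F \o G) (g \o f).
Proof. by move=> Ff Gg t x; rewrite !comp_lfunE Ff Gg. Qed.

Lemma adjoint_unique P X Q Y (p : 'Hom(P, 'Hom(X, K^o)))
    (q : 'Hom(Q, 'Hom(Y, K^o))) F G f :
  injective p -> adjoint p q F f -> adjoint p q G f -> F = G.
Proof.
by move=> pI Ff Gf; apply/lfunP=> t; apply: pI; apply/lfunP=> x; rewrite Ff Gf.
Qed.

(** As an equality of linear maps, adjointness can be checked on pure tensors alone. *)
Lemma adjointP P X Q Y (p : 'Hom(P, 'Hom(X, K^o)))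
    (q : 'Hom(Q, 'Hom(Y, K^o))) (F : 'Hom(Q, P)) (f : 'Hom(X, Y)) :
  (p \o F = transpose f \o q)%VF <-> adjoint p q F f.
Proof.
split=> [e t x|Ff]; first by rewrite -comp_lfunE e comp_lfunE transposeE.
by apply/lfunP=> t; apply/lfunP=> x; rewrite !comp_lfunE transposeE Ff.
Qed.

Lemma adjoint_tmap P X Q Y P' X' Q' Y' (p : 'Hom(P, 'Hom(X, K^o)))
    (q : 'Hom(Q, 'Hom(Y, K^o))) (p' : 'Hom(P', 'Hom(X', K^o)))
    (q' : 'Hom(Q', 'Hom(Y', K^o))) F f F' f' :
  adjoint p q F f -> adjoint p' q' F' f' ->
  adjoint (tens_pairing p p') (tens_pairing q q') (F \ot F') (f \ot f').
Proof.
move=> Ff Ff'; apply/adjointP; apply: tensor_ext => a b.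
apply: tensor_ext => x y.
rewrite (comp_lfunE (tens_pairing _ _)) (comp_lfunE (transpose _)) transposeE.
by rewrite !tmapE !tens_pairingE Ff Ff'.
Qed.

(** Freezing [z] leaves a linear map on the inner tensor product, where [tensor_ext] applies. The
    factors may differ, as the associators require. *)
Lemma tensor3l_ext X Y Z (U : vectType K)
    (f g : 'Hom(tensor (tensor X Y) Z, U)) :
  (forall x y z, f (x \ox y \ox z) = g (x \ox y \ox z)) -> f = g.
Proof.
move=> efg; apply: tensor_ext => t z.
have L (h : 'Hom(tensor (tensor X Y) Z, U)) :
    linear (fun t : tensor X Y => h (t \ox z)).
  by move=> a u v; rewrite tens_linl linearP.
rewrite -(linfun_linear (L f)) -(linfun_linear (L g)).
by congr (fun_of_lfun _ _); apply: tensor_ext => x y; rewrite !linfun_linear.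
Qed.

Lemma tensor3r_ext X Y Z (U : vectType K)
    (f g : 'Hom(tensor X (tensor Y Z), U)) :
  (forall x y z, f (x \ox (y \ox z)) = g (x \ox (y \ox z))) -> f = g.
Proof.
move=> efg; apply: tensor_ext => x t.
have L (h : 'Hom(tensor X (tensor Y Z), U)) :
    linear (fun t : tensor Y Z => h (x \ox t)).
  by move=> a u v; rewrite tens_linr linearP.
rewrite -(linfun_linear (L f)) -(linfun_linear (L g)).
by congr (fun_of_lfun _ _); apply: tensor_ext => y z; rewrite !linfun_linear.
Qed.

Section Associators.
Context {P X Q Y R Z : vectType K} (p : 'Hom(P, 'Hom(X, K^o)))
  (q : 'Hom(Q, 'Hom(Y, K^o))) (r : 'Hom(R, 'Hom(Z, K^o))).

Lemma adjoint_assocr :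
  adjoint (tens_pairing p (tens_pairing q r))
    (tens_pairing (tens_pairing p q) r) (assocr P Q R) (assocl X Y Z).
Proof.
apply/adjointP; apply: tensor3l_ext => a b c; apply: tensor3r_ext => x y z.
rewrite (comp_lfunE (tens_pairing _ _)) (comp_lfunE (transpose _)) transposeE.
by rewrite assocrE assoclE !tens_pairingE mulrA.
Qed.

Lemma adjoint_assocl :
  adjoint (tens_pairing (tens_pairing p q) r)
    (tens_pairing p (tens_pairing q r)) (assocl P Q R) (assocr X Y Z).
Proof.
apply/adjointP; apply: tensor3r_ext => a b c; apply: tensor3l_ext => x y z.
rewrite (comp_lfunE (tens_pairing _ _)) (comp_lfunE (transpose _)) transposeE.
by rewrite assocrE assoclE !tens_pairingE mulrA.
Qed.

End Associators.

(** Tensoring the inverses of [p] and [q] inverts [p \ot q]; finite dimension enters through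
    [pairing_bij]. *)
Lemma tens_pairing_bij P X Q Y (p : 'Hom(P, 'Hom(X, K^o)))
    (q : 'Hom(Q, 'Hom(Y, K^o))) :
  bijective p -> bijective q -> bijective (tens_pairing p q).
Proof.
move=> [p' pK Kp] [q' qK Kq].
(* Bijectivity only yields inverse functions, which must be linear before they can be tensored. *)
have lin (U V : vectType K) (h : 'Hom(U, V)) h' : cancel h h' -> cancel h' h -> linear h'.
  by move=> hK Kh a x y; apply: (can_inj hK); rewrite linearP /= !Kh.
have p'L := lin _ _ p p' pK Kp; have q'L := lin _ _ q q' qK Kq.
suff B : bijective (p \ot q).
  by apply: (eq_bij (bij_comp (pairing_bij X Y) B)) => t /=; rewrite comp_lfunE.
exists (linfun p' \ot linfun q') => t; rewrite -comp_lfunE -[RHS]id_lfunE;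
  congr (fun_of_lfun _ _); apply: tensor_ext => x y;
  rewrite comp_lfunE !tmapE !id_lfunE (linfun_linear p'L) (linfun_linear q'L).
  by rewrite pK qK.
by rewrite Kp Kq.
Qed.

End Adjoints.

(** * The dual structure maps and the reassociations as adjoints *)

Section DualBialgebra.
Context {K : fieldType} {A : vectType K}.
Implicit Types (mu : 'Hom(T3 A, A)) (Delta : 'Hom(A, T3 A)).

Local Notation dual := 'Hom(A, K^o).
(** The identity of $A^*$ is the evaluation pairing; the others pair tensor powers of $A^*$ and $A$,
    bracketed as [T3] and [T5] are. *)
Local Notation p1 := (\1%VF : 'End(dual)).
Local Notation p2 := (tens_pairing p1 p1).
Local Notation p3 := (tens_pairing p2 p1).
Local Notation p5 := (tens_pairing (tens_pairing p3 p1) p1).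

(** This form of [pairing3] is the one to which [adjoint_tmap] applies. *)
Lemma pairing3_tens : pairing3 A = p3.
Proof.
apply: T3_ext => a b c; apply: T3_ext => x y z.
by rewrite pairing3E !tens_pairingE !id_lfunE.
Qed.

Lemma adjoint_dual_prod Delta : adjoint p1 p3 (dual_prod Delta) Delta.
Proof.
by move=> t x; rewrite -pairing3_tens id_lfunE comp_lfunE transposeE.
Qed.

Lemma adjoint_dual_coprod mu : adjoint p3 p1 (dual_coprod mu) mu.
Proof.
apply/adjointP; apply/lfunP=> t; apply: T3_ext => x y z.
rewrite (comp_lfunE (tens_pairing _ _)) (comp_lfunE (transpose _)) transposeE.
by rewrite -pairing3_tens dual_coprodE id_lfunE.
Qed.

(** Moving brackets on the $A^*$ side is undone by moving them back on the $A$ side, so each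
    associator is adjoint to its inverse. *)
Lemma adjoint_split_mid :
  adjoint (tens_pairing (tens_pairing p1 p3) p1) p5
    (split_mid dual) (join_mid A).
Proof.
apply: adjoint_tmap _ (adjoint1 _); apply: adjoint_comp (adjoint_assocr _ _ _) _.
exact: adjoint_tmap (adjoint_assocr _ _ _) (adjoint1 _).
Qed.

Lemma adjoint_join_mid :
  adjoint p5 (tens_pairing (tens_pairing p1 p3) p1)
    (join_mid dual) (split_mid A).
Proof.
apply: adjoint_tmap _ (adjoint1 _); apply: adjoint_comp _ (adjoint_assocl _ _ _).
exact: adjoint_tmap (adjoint_assocl _ _ _) (adjoint1 _).
Qed.

Lemma adjoint_split_right :
  adjoint (tens_pairing p2 p3) p5 (split_right dual) (join_right A).
Proof.
apply: adjoint_comp (adjoint_assocr _ _ _) _.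
exact: adjoint_tmap (adjoint_assocr _ _ _) (adjoint1 _).
Qed.

Lemma adjoint_join_right :
  adjoint p5 (tens_pairing p2 p3) (join_right dual) (split_right A).
Proof.
apply: adjoint_comp _ (adjoint_assocl _ _ _).
exact: adjoint_tmap (adjoint_assocl _ _ _) (adjoint1 _).
Qed.

Lemma p1_bij : bijective p1.
Proof. by exists id => t; rewrite id_lfunE. Qed.

Lemma p5_bij : bijective p5.
Proof. by do !apply: tens_pairing_bij; apply: p1_bij. Qed.

(** * Associativity and coassociativity of the dual *)

Lemma dual_totally_associative Delta :
  totally_coassociative Delta -> totally_associative (dual_prod Delta).
Proof.
have D := adjoint_dual_prod Delta.
have I := @adjoint1 K dual A p1.
have adjl : adjoint p1 p5
    (dual_prod Delta \o (dual_prod Delta \ot \1 \ot \1))%VF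
    ((Delta \ot \1 \ot \1) \o Delta)%VF.
  exact: adjoint_comp D (adjoint_tmap (adjoint_tmap D I) I).
have adjm : adjoint p1 p5
    (dual_prod Delta \o (\1 \ot dual_prod Delta \ot \1) \o split_mid dual)%VF
    (join_mid A \o (\1 \ot Delta \ot \1) \o Delta)%VF.
  (* Composition reverses under adjunction: [split_mid] is innermost on $A^*$, so [join_mid] has to
     be isolated as the outermost factor on $A$. *)
  rewrite -[X in adjoint _ _ _ X]comp_lfunA.
  apply: adjoint_comp adjoint_split_mid.
  exact: adjoint_comp D (adjoint_tmap (adjoint_tmap I D) I).
have adjr : adjoint p1 p5
    (dual_prod Delta \o (\1 \ot \1 \ot dual_prod Delta) \o split_right dual)%VF
    (join_right A \o (\1 \ot \1 \ot Delta) \o Delta)%VF.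
  rewrite -[X in adjoint _ _ _ X]comp_lfunA.
  apply: adjoint_comp adjoint_split_right.
  exact: adjoint_comp D (adjoint_tmap (adjoint_tmap I I) D).
move=> [e1 e2]; split; apply: (adjoint_unique (bij_inj p1_bij)).
- exact: adjl.
- by rewrite e1.
- exact: adjm.
- by rewrite e2.
Qed.

Lemma dual_totally_coassociative mu :
  totally_associative mu -> totally_coassociative (dual_coprod mu).
Proof.
have M := adjoint_dual_coprod mu.
have I := @adjoint1 K dual A p1.
have adjl : adjoint p5 p1
    ((dual_coprod mu \ot \1 \ot \1) \o dual_coprod mu)%VF
    (mu \o (mu \ot \1 \ot \1))%VF.
  exact: adjoint_comp (adjoint_tmap (adjoint_tmap M I) I) M.
have adjm : adjoint p5 p1
    (join_mid dual \o (\1 \ot dual_coprod mu \ot \1) \o dual_coprod mu)%VF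
    (mu \o (\1 \ot mu \ot \1) \o split_mid A)%VF.
  rewrite -comp_lfunA; apply: adjoint_comp adjoint_join_mid _.
  exact: adjoint_comp (adjoint_tmap (adjoint_tmap I M) I) M.
have adjr : adjoint p5 p1
    (join_right dual \o (\1 \ot \1 \ot dual_coprod mu) \o dual_coprod mu)%VF
    (mu \o (\1 \ot \1 \ot mu) \o split_right A)%VF.
  rewrite -comp_lfunA; apply: adjoint_comp adjoint_join_right _.
  exact: adjoint_comp (adjoint_tmap (adjoint_tmap I I) M) M.
move=> [e1 e2]; split; apply: (adjoint_unique (bij_inj p5_bij)).
- exact: adjl.
- by rewrite e1.
- exact: adjm.
- by rewrite e2.
Qed.

(** * Contractions and the compatibility condition *)

(** Both sides are linear in [s], so pure tensors suffice. In the uses, [j] inserts a vector into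
    one slot and fixes the other two. *)
Lemma contraction_ext (j : A -> T3 A) (G : 'End(T3 dual)) (F : 'End(dual)) u x :
    linear j ->
    (forall a b c, pairing3 A (G (a \ox b \ox c)) u
       = F (linfun (fun v => pairing3 A (a \ox b \ox c) (j v) : K^o)) x) ->
  forall s, pairing3 A (G s) u
    = F (linfun (fun v => pairing3 A s (j v) : K^o)) x.
Proof.
move=> jL e s.
(* Written with a transpose, the contraction is visibly linear in [t]. *)
have cE t : linfun (fun v => pairing3 A t (j v) : K^o)
    = transpose (linfun j) (pairing3 A t).
  apply/lfunP=> v; rewrite transposeE (linfun_linear jL) linfun_linear // => a y z.
  by rewrite jL linearP.
pose l t : K^o := pairing3 A (G t) u.
pose r t : K^o := F (transpose (linfun j) (pairing3 A t)) x.
have lL : linear l.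
  by move=> a y z; rewrite /l !linearP add_lfunE scale_lfunE.
have rL : linear r.
  by move=> a y z; rewrite /r !linearP add_lfunE scale_lfunE.
rewrite cE -/(l s) -/(r s) -(linfun_linear lL) -(linfun_linear rL).
congr (fun_of_lfun _ _); apply: T3_ext => a b c.
by rewrite !linfun_linear // /l e cE.
Qed.

(* Pairing with all but one of x, y, z contracts s to a functional on A in the
   remaining slot, and F, acting in that slot, commutes with the contraction. *)
Lemma pairing3_tmapl (F : 'End(dual)) s x y z :
  pairing3 A ((F \ot \1 \ot \1)%VF s) (x \ox y \ox z)
    = F (linfun (fun v => pairing3 A s (v \ox y \ox z) : K^o)) x.
Proof.
have jL : linear (fun v : A => v \ox y \ox z) by move=> a v w; rewrite !tens_linl.
apply: (contraction_ext jL) => a b c.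
(* A pure tensor contracts to a multiple of its free factor, and [F] lets the scalar through. *)
have -> : linfun (fun v => pairing3 A (a \ox b \ox c) (v \ox y \ox z) : K^o)
    = (b y * c z) *: a.
  apply/lfunP=> v; rewrite linfun_linear => [|k w w'].
    by rewrite pairing3E scale_lfunE /GRing.scale /= -mulrA mulrC.
  by rewrite jL linearP.
rewrite !tmapE !id_lfunE pairing3E linearZ scale_lfunE.
by rewrite /GRing.scale /= -mulrA mulrC.
Qed.

Lemma pairing3_tmapm (F : 'End(dual)) s x y z :
  pairing3 A ((\1 \ot F \ot \1)%VF s) (x \ox y \ox z)
    = F (linfun (fun v => pairing3 A s (x \ox v \ox z) : K^o)) y.
Proof.
have jL : linear (fun v : A => x \ox v \ox z).
  by move=> a v w; rewrite tens_linr tens_linl.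
apply: (contraction_ext jL) => a b c.
have -> : linfun (fun v => pairing3 A (a \ox b \ox c) (x \ox v \ox z) : K^o)
    = (a x * c z) *: b.
  apply/lfunP=> v; rewrite linfun_linear => [|k w w'].
    by rewrite pairing3E scale_lfunE /GRing.scale /= mulrAC.
  by rewrite jL linearP.
rewrite !tmapE !id_lfunE pairing3E linearZ scale_lfunE.
by rewrite /GRing.scale /= mulrAC.
Qed.

Lemma pairing3_tmapr (F : 'End(dual)) s x y z :
  pairing3 A ((\1 \ot \1 \ot F)%VF s) (x \ox y \ox z)
    = F (linfun (fun v => pairing3 A s (x \ox y \ox v) : K^o)) z.
Proof.
have jL : linear (fun v : A => x \ox y \ox v) by move=> a v w; rewrite tens_linr.
apply: (contraction_ext jL) => a b c.
have -> : linfun (fun v => pairing3 A (a \ox b \ox c) (x \ox y \ox v) : K^o)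
    = (a x * b y) *: c.
  apply/lfunP=> v; rewrite linfun_linear => [|k w w'].
    by rewrite pairing3E scale_lfunE.
  by rewrite jL linearP.
by rewrite !tmapE !id_lfunE pairing3E linearZ scale_lfunE.
Qed.

(** Used to carry the operators $L$, $M$, $R$ of $A$ from $\Delta$ over to the functionals. *)
Lemma pairing3_transpose (f g h : 'End(A)) s u :
  pairing3 A ((transpose f \ot transpose g \ot transpose h)%VF s) u
    = pairing3 A s ((f \ot g \ot h)%VF u).
Proof.
have T (k : 'End(A)) : adjoint p1 p1 (transpose k) k.
  by move=> t x; rewrite !id_lfunE transposeE.
rewrite pairing3_tens.
exact: adjoint_tmap (adjoint_tmap (T f) (T g)) (T h) _ _.
Qed.

Lemma transpose1 : transpose (\1 : 'End(A)) = \1%VF.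
Proof.
by apply/lfunP=> xi; apply/lfunP=> x; rewrite transposeE !id_lfunE.
Qed.

Lemma dual_infinitesimal_compat mu Delta :
  infinitesimal_compat mu Delta ->
  infinitesimal_compat (dual_prod Delta) (dual_coprod mu).
Proof.
move=> compat xi eta gamma; apply: (bij_inj (pairing3_bij A)).
apply: T3_ext => x y z.
rewrite dual_coprodE dual_prodE compat !linearD !add_lfunE /=.
rewrite pairing3_tmapl pairing3_tmapm pairing3_tmapr LmuE MmuE RmuE.
(* Contracting $\mu^*(\gamma)$ with $y$ and $z$ gives $v \mapsto \gamma(\mu(v,y,z))$: the $L$ term
   of $A^*$ meets the operator $R_\mu(y,z)$. The next two contractions likewise produce $M_\mu(x,z)$
   and $L_\mu(x,y)$. *)
have -> : linfun (fun v => pairing3 A (dual_coprod mu gamma) (v \ox y \ox z) : K^o)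
    = transpose (Rmu mu y z) gamma.
  apply/lfunP=> v; rewrite linfun_linear => [|k w w'].
    by rewrite dual_coprodE transposeE RmuE.
  by rewrite !tens_linl linearP.
have -> : linfun (fun v => pairing3 A (dual_coprod mu eta) (x \ox v \ox z) : K^o)
    = transpose (Mmu mu x z) eta.
  apply/lfunP=> v; rewrite linfun_linear => [|k w w'].
    by rewrite dual_coprodE transposeE MmuE.
  by rewrite tens_linr tens_linl linearP.
have -> : linfun (fun v => pairing3 A (dual_coprod mu xi) (x \ox y \ox v) : K^o)
    = transpose (Lmu mu x y) xi.
  apply/lfunP=> v; rewrite linfun_linear => [|k w w'].
    by rewrite dual_coprodE transposeE LmuE.
  by rewrite tens_linr linearP.
rewrite !dual_prodE -!pairing3_transpose transpose1 !tmapE !id_lfunE.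
(* The same three terms stand on both sides, in opposite orders. *)
by rewrite -addrA addrC; congr (_ + _); exact: addrC.
Qed.

End DualBialgebra.

Unset Implicit Arguments.

Theorem theorem4p10 (K : fieldType) (charK : [pchar K] =i pred0)
    (A : vectType K) (mu : 'Hom(T3 A, A)) (Delta : 'Hom(A, T3 A))
    (bialgA : totally_assoc_inf_bialgebra mu Delta) :
  @totally_assoc_inf_bialgebra K 'Hom(A, K^o) (dual_prod Delta) (dual_coprod mu).
Proof.
case: bialgA => assoc coassoc compat; split.
- exact: dual_totally_associative.
- exact: dual_totally_coassociative.
- exact: dual_infinitesimal_compat.
Qed.
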